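(* Let $qF$ be the quasi-$F$ covering operator. (i) $\mathcal{S}(\beta\mathbb{N},qF)$ has minimum $\alpha\mathbb{N}$. (ii) If $K$ is a compact Hausdorff almost-$P$ space, then $\mathcal{S}(K,qF)=\{K\}$, which has minimum $K$.
   Context: $\mathbf{Comp}$ is the category of compact Hausdorff spaces and continuous maps. For $X,Y\in\mathbf{Comp}$, a continuous surjection $f:Y\to X$ is a covering map if it is irreducible, i.e. $f(F)\neq X$ for every proper closed $F\subset Y$; then $(Y,f)$ is called a cover of $X$. For covers $(Y_1,f_1),(Y_2,f_2)$ of $X$, $(Y_1,f_1)\le (Y_2,f_2)$ means there is a continuous $f:Y_2\to Y_1$ with $f_2=f_1\circ f$; covers that are $\le$ each other are identified, and $\operatorname{cov}X$ is the resulting ordered set. A space $X$ is quasi-$F$ if every dense cozero-set of $X$ is $C^*$-embedded in $X$ (every bounded continuous real-valued function on it extends continuously to $X$). The quasi-$F$ covering operator assigns to each $X\in\mathbf{Comp}$ the minimum $(qFX,qF_X)$ in $\{(Y,f)\in\operatorname{cov}X: Y\text{ is quasi-}F\}$ (it exists). A space is almost-$P$ if it has no proper dense cozero-set (every almost-$P$ space is quasi-$F$). For $K\in\mathbf{Comp}$ with $qFK=K$ (i.e. $K$ quasi-$F$), $\mathcal{S}(K,qF)=\{X\in\mathbf{Comp}: qFX=K\}$, where $X$ is identified with the pair $(X,qF_X)$, $qF_X:K=qFX\to X$; that is, the elements are pairs $(X,f)$ with $f:K\to X$ a covering map such that $(K,f)$ is (equivalent in $\operatorname{cov} X$ to) the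 quasi-$F$ cover of $X$. The order is: $(X_1,f_1)\le(X_2,f_2)$ iff there is a continuous $f:X_2\to X_1$ with $f_1=f\circ f_2$; pairs that are $\le$ each other are identified. $\alpha\mathbb{N}$ and $\beta\mathbb{N}$ are the one-point and the Čech–Stone compactifications of the discrete space $\mathbb{N}$. *)

(* Defs.v *)
From HB Require Import structures.
From mathcomp Require Import all_boot all_order all_algebra.
From mathcomp Require Import all_classical all_reals all_analysis.

Set Implicit Arguments.
Unset Strict Implicit.
Unset Printing Implicit Defensive.

Import Order.TTheory GRing.Theory Num.Theory numFieldNormedType.Exports.

Local Open Scope classical_set_scope.
Local Open Scope ring_scope.

Definition compact_hausdorff (X : topologicalType) : Prop :=
  compact [set: X] /\ hausdorff_space X.

Definition irreducible_map (Y X : topologicalType) (f : Y -> X) : Prop :=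
  forall F : set Y, closed F -> F <> setT -> f @` F <> setT.

Definition covering_map (Y X : topologicalType) (f : Y -> X) : Prop :=
  [/\ continuous f, range f = setT & irreducible_map f].

(* Carrier of the covers of X; it lives in a bigger universe, and covers are
   compared with [cover_le], without quotienting by the induced equivalence. *)
Record space_over (X : topologicalType) := SpaceOver {
  over_space : topologicalType;
  over_map : over_space -> X }.

Definition is_cover (X : topologicalType) (c : space_over X) : Prop :=
  compact_hausdorff (over_space c) /\ covering_map (@over_map X c).

Definition cover_le (X : topologicalType) (c1 c2 : space_over X) : Prop :=
  exists f : over_space c2 -> over_space c1,
    continuous f /\ @over_map X c2 = @over_map X c1 \o f.

Definition is_minimum (T : Type) (le : T -> T -> Prop) (A : T -> Prop) (m : T)
    : Prop :=
  A m /\ forall x, A x -> le m x.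

Definition cozero_set (R : realType) (X : topologicalType) (U : set X) : Prop :=
  exists2 f : X -> R, continuous f & U = [set x | f x != 0].

(* A real function on the subspace U is represented by a function on X whose
   values outside U are irrelevant. *)
Definition Cstar_embedded (R : realType) (X : topologicalType) (U : set X)
    : Prop :=
  forall g : X -> R, {within U, continuous g} -> bounded_set (g @` U) ->
    exists2 h : X -> R, continuous h & forall x, U x -> h x = g x.

Definition quasi_F (R : realType) (X : topologicalType) : Prop :=
  forall U : set X, cozero_set R U -> dense U -> Cstar_embedded R U.

Definition almost_P (R : realType) (X : topologicalType) : Prop :=
  forall U : set X, cozero_set R U -> dense U -> U = setT.

(* Being the minimum of a set of covers determines a cover up to [cover_le] in
   both directions, i.e. determines an element of cov X. *)
Definition is_qF_cover (R : realType) (X : topologicalType) (c : space_over X)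
    : Prop :=
  is_minimum (@cover_le X)
    (fun c' => is_cover c' /\ quasi_F R (over_space c')) c.

Record space_under (K : topologicalType) := SpaceUnder {
  under_space : topologicalType;
  under_map : K -> under_space }.

Definition S_qF (R : realType) (K : topologicalType) (p : space_under K)
    : Prop :=
  compact_hausdorff (under_space p) /\
  is_qF_cover R (SpaceOver (@under_map K p)).

Definition under_le (K : topologicalType) (p1 p2 : space_under K) : Prop :=
  exists f : under_space p2 -> under_space p1,
    continuous f /\ @under_map K p1 = f \o @under_map K p2.

Definition under_equiv (K : topologicalType) (p1 p2 : space_under K) : Prop :=
  under_le p1 p2 /\ under_le p2 p1.

(* Tychonoff's construction: the closure of the image of X in the product
   [0,1]^C(X,[0,1]), taken inside R^C(X,[0,1]). *)
Definition unit_valued_maps (R : realType) (X : topologicalType)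
    : set (X -> R) :=
  [set f : X -> R | continuous f /\ forall x, 0 <= f x <= 1].

Definition stone_cech_eval (R : realType) (X : topologicalType) (x : X)
    : prod_topology (fun _ : set_type (@unit_valued_maps R X) => R) :=
  fun f => set_val f x.

Definition stone_cech (R : realType) (X : topologicalType) : topologicalType :=
  set_type (closure (range (@stone_cech_eval R X))).

(* Main.v *)
Require Import Defs.
From mathcomp Require Import all_boot all_order all_algebra.
From mathcomp Require Import all_classical all_reals all_analysis.
From mathcomp Require Import ring lra.

Set Implicit Arguments.
Unset Strict Implicit.
Unset Printing Implicit Defensive.

Import Order.TTheory GRing.Theory Num.Theory numFieldNormedType.Exports.

Local Open Scope classical_set_scope.
Local Open Scope ring_scope.

(** Write e : N -> bN for the canonical map into the Stone-Cech
    compactification and aN for the one-point compactification.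

    Part (i).  The points e n are isolated in bN and form a dense set, so the
    map f : bN -> aN sending e n to n and everything else to infinity is
    continuous, and it is irreducible because a closed set mapped onto aN
    contains every e n ([stone_cech_to_opc_covering]).  A dense set of bN
    contains all e n, and a bounded function on N extends to bN, whence bN is
    quasi-F ([stone_cech_quasi_F]).  Now let g : Y -> aN be a cover with Y
    quasi-F.  The subset N of aN is a dense cozero-set: it is the complement of
    the zero-set of the function n |-> 1/(n+1), infinity |-> 0.  Hence its
    preimage U in Y is a dense cozero-set too, and for every u : N -> [0,1] the
    function u o g on U extends to Y.  These extensions are the coordinates of
    a map h : Y -> bN with h = e o g on U, hence with f o h = g
    ([quasi_F_cover_opc_nat_factor]).  So (bN, f) is the quasi-F cover of aN.
    Finally aN is least: if p : bN -> X is any covering map, irreducibility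
    makes the fiber of p through the isolated point e n a singleton, so f is
    constant on the fibers of p and factors through the quotient map p
    ([stone_cech_to_opc_factor]).

    Part (ii).  Let p : K -> X be the quasi-F cover of X with K almost-P.  The
    preimage under p of a dense cozero-set is a dense cozero-set, so X is
    almost-P as well, hence quasi-F, and the identity of X competes with p.
    Minimality of p yields a continuous section s of p; since p is irreducible
    and p maps the closed set s(X) onto X, the section is onto, and p is a
    homeomorphism ([almost_P_le_S_qF]). *)

(** * Dense sets, covering maps and quotients *)

Lemma eq_on_open_of_dense (X Y : topologicalType) (D U : set X)
    (f g : X -> Y) :
  hausdorff_space Y -> dense D -> open U ->
  {in U, continuous f} -> {in U, continuous g} ->
  (forall x, U x -> D x -> f x = g x) -> forall x, U x -> f x = g x.
Proof.
move=> hY dD oU cf cg fg x Ux; apply: hY => A B Afx Bgx.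
have nO : nbhs x (U `&` (f @^-1` A `&` g @^-1` B)).
  apply: filterI; first exact: open_nbhs_nbhs.
  by apply: filterI; [exact: (cf x (mem_set Ux))|exact: (cg x (mem_set Ux))].
have [z [zO Dz]] : (U `&` (f @^-1` A `&` g @^-1` B))° `&` D !=set0.
  by apply: dD; [exists x | exact: open_interior].
have [Uz [Az Bz]] := interior_subset zO.
by exists (f z); split => //; rewrite (fg z).
Qed.

Lemma eq_of_dense (X Y : topologicalType) (D : set X) (f g : X -> Y) :
  hausdorff_space Y -> dense D -> continuous f -> continuous g ->
  (forall x, D x -> f x = g x) -> f = g.
Proof.
move=> hY dD cf cg fg; apply/funext => x.
by apply: (eq_on_open_of_dense hY dD openT (f := f) (g := g)) => // y _; exact: fg.
Qed.

Lemma closed_dense_setT (X : topologicalType) (D F : set X) :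
  dense D -> closed F -> D `<=` F -> F = setT.
Proof.
move=> dD cF DF; rewrite -subTset => x _; apply: contrapT => Fx.
have [z [Fz /DF]] : ~` F `&` D !=set0 by apply: dD; [exists x|exact: closed_openC].
by [].
Qed.

Lemma compact_closed_map (X Y : topologicalType) (f : X -> Y) (F : set X) :
  compact [set: X] -> hausdorff_space Y -> continuous f -> closed F ->
  closed (f @` F).
Proof.
move=> cX hY cf cF; apply: compact_closed => //.
apply: continuous_compact; first exact: continuous_subspaceT.
exact: (subclosed_compact cF cX).
Qed.


(** If the open set O missed the preimage of D, then f(~O) would contain D;
    but f(~O) is closed and, by irreducibility, proper. *)
Lemma preimage_dense (X Y : topologicalType) (f : Y -> X) (D : set X) :
  compact [set: Y] -> hausdorff_space X -> covering_map f -> dense D ->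
  dense (f @^-1` D).
Proof.
move=> cY hX [cf sf irr] dD O [y0 Oy0] oO.
have clO : closed (~` O) by exact: open_closedC.
have nT : f @` (~` O) <> setT.
  by apply: irr => // OT; have : (~` O) y0 by rewrite OT.
have [x [nx Dx]] : ~` (f @` (~` O)) `&` D !=set0.
  apply: dD; last by apply: closed_openC; exact: compact_closed_map.
  by apply/set0P/eqP => /(congr1 setC); rewrite setCK setC0.
have [y _ fy] : range f x by rewrite sf.
exists y; split; last by rewrite /preimage /= fy.
by apply: contrapT => Oy; apply: nx; exists y.
Qed.

(** Any other point in the fiber of y would make the proper closed set
    complementary to [y] map onto X. *)
Lemma irreducible_fiber_isolated (X Y : topologicalType) (f : Y -> X) (y y' : Y) :
  range f = setT -> irreducible_map f -> open [set y] -> f y' = f y -> y' = y.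
Proof.
move=> sf irr oy fyy'; apply: contrapT => yy'.
apply: (irr (~` [set y])); first exact: open_closedC.
  by move=> e; have : (~` [set y]) y by [rewrite e]; exact.
rewrite -subTset => x _; have [z _ zx] : range f x by rewrite sf.
have [zy|zy] := pselect (z = y); last by exists z.
by exists y' => //; rewrite fyy' -zy.
Qed.

(** A continuous surjection from a compact space to a Hausdorff space is closed,
    hence a quotient map. *)
Lemma continuous_factor (K X Y : topologicalType) (p : K -> X) (f : K -> Y) :
  compact [set: K] -> hausdorff_space X -> continuous p -> range p = setT ->
  continuous f -> (forall y y', p y = p y' -> f y = f y') ->
  exists2 h : X -> Y, continuous h & f = h \o p.
Proof.
move=> cK hX cp sp cf pf.
have /choice[s ps] : forall x, exists y, p y = x.
  by move=> x; have [y _ yx] : range p x by [rewrite sp]; exists y.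
have fE : f = (f \o s) \o p by apply/funext => y; apply: pf; rewrite ps.
exists (f \o s) => //; apply/continuous_closedP => C clC.
rewrite (_ : _ @^-1` C = p @` (f @^-1` C)).
  by apply: compact_closed_map => //; exact: (continuous_closedP _).1.
apply/seteqP; split => [x Cx|x [y Cy <-]]; first by exists (s x); rewrite ?ps.
by rewrite /preimage /= -[f (s (p y))]/(((f \o s) \o p) y) -fE.
Qed.

(** * Subspaces, products and the Stone-Cech compactification *)

Lemma set_type_compact (X : topologicalType) (A : set X) :
  compact A -> compact [set: set_type A].
Proof.
move=> cA F PF _.
have FA : (set_val @ F) A.
  by rewrite /fmap /=; apply: filterE => y; exact: set_valP.
have [x [Ax clx]] := cA _ (fmap_proper_filter _ PF) FA.
exists (exist _ x (mem_set Ax)); split => // U V FU [_ [[W oW <-] /= Wx WV]].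
have [] := clx (set_val @` U) W.
- exact: filterS (@preimage_image _ _ set_val U) FU.
- by apply: open_nbhs_nbhs.
- by move=> _ [[y Uy <-] Wy]; exists y; split => //; exact: WV.
Qed.

Lemma set_type_hausdorff (X : topologicalType) (A : set X) :
  hausdorff_space X -> hausdorff_space (set_type A).
Proof.
move=> hX x y clxy; apply: val_inj; apply: hX => U V Ux Vy.
have [] := clxy (set_val @^-1` U) (set_val @^-1` V).
- exact: (@initial_continuous _ _ (@set_val _ A)).
- exact: (@initial_continuous _ _ (@set_val _ A)).
- by move=> z [Uz Vz]; exists (set_val z).
Qed.

Lemma prod_topology_continuous (X : topologicalType) (I : eqType)
    (T : I -> topologicalType) (f : X -> prod_topology T) :
  (forall i, continuous (fun x => f x i)) -> continuous f.
Proof.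
move=> cf x; apply/cvg_sup => i.
have := @continuous_comp_initial _ X (T i) (fun g : forall j, T j => g i) f.
by move=> /(_ (cf i) x).
Qed.

Lemma continuous_affine (R : realType) (Y : topologicalType) (h : Y -> R) (a b : R) :
  continuous h -> continuous (fun y => a * h y + b).
Proof.
move=> ch y; apply: cvgD; last exact: cvg_cst.
by apply: cvgM; [exact: cvg_cst|exact: ch].
Qed.

Section StoneCech.
Variables (R : realType) (X : topologicalType).

Local Notation bX := (stone_cech R X).
Local Notation eval := (@stone_cech_eval R X).

Lemma stone_cech_unit_subproof (x : X) :
  eval x \in closure (range eval).
Proof. by apply/mem_set/subset_closure; exists x. Qed.

Definition stone_cech_unit (x : X) : bX :=
  exist _ (eval x) (stone_cech_unit_subproof x).

(** The unique continuous extension of u along the canonical map. *)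
Definition stone_cech_coord (u : set_type (@unit_valued_maps R X)) (y : bX) : R :=
  set_val y u.

Lemma stone_cech_coord_continuous u : continuous (stone_cech_coord u).
Proof.
move=> y; apply: (@continuous_comp _ _ _ (set_val : bX -> _) (@proj _ (fun=> R) u)).
  exact: (@initial_continuous _ _ (@set_val _ (closure (range eval)))).
exact: proj_continuous.
Qed.

Lemma continuous_to_stone_cech (Y : topologicalType) (h : Y -> bX) :
  (forall u, continuous (stone_cech_coord u \o h)) -> continuous h.
Proof.
move=> ch; apply: (@continuous_comp_initial bX).
exact: prod_topology_continuous.
Qed.

Lemma stone_cech_unit_dense : dense (range stone_cech_unit).
Proof.
move=> _ /[swap] -[W oW <-] [y /= Wy].
have [_ [[x _ <-] Wx]] := set_valP y W (open_nbhs_nbhs (conj oW Wy)).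
by exists (stone_cech_unit x).
Qed.

Lemma stone_cech_compact_hausdorff : compact_hausdorff bX.
Proof.
split.
  apply: set_type_compact.
  have cube : compact [set y : prod_topology
      (fun _ : set_type (@unit_valued_maps R X) => R) | forall u, `[0, 1]%classic (y u)].
    by apply: (@tychonoff _ (fun=> R) (fun=> `[0, 1]%classic)) => _; exact: segment_compact.
  apply: (subclosed_compact (@closed_closure _ _) cube).
  rewrite closureE; apply: smallest_sub.
    by apply: compact_closed cube; apply: hausdorff_product => _; exact: Rhausdorff.
  by move=> _ [x _ <-] u /=; rewrite in_itv /=; exact: (set_valP u).2.
apply: set_type_hausdorff; apply: hausdorff_product => _; exact: Rhausdorff.
Qed.

(** The function (g + M) / 2M takes values in the unit interval, so it is the
    restriction of a coordinate; undo the rescaling on that coordinate. *)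
Lemma stone_cech_extension (g : X -> R) (M : R) :
  0 < M -> continuous g -> (forall x, `|g x| <= M) ->
  exists2 h : bX -> R, continuous h & forall x, h (stone_cech_unit x) = g x.
Proof.
move=> M0 cg gM; pose u x := (g x + M) / (2 * M).
have uP : unit_valued_maps u.
  split.
    rewrite (_ : u = (fun x => (2 * M)^-1 * g x + 2^-1)).
      exact: continuous_affine.
    by apply/funext => x; rewrite /u; field; lra.
  move=> x; have := gM x; rewrite ler_norml => /andP[gl gr].
  rewrite /u; apply/andP; split; first by apply: divr_ge0; lra.
  rewrite ler_pdivrMr; lra.
pose v := exist _ u (mem_set uP) : set_type (@unit_valued_maps R X).
exists (fun y => 2 * M * stone_cech_coord v y - M).
  exact/continuous_affine/stone_cech_coord_continuous.
move=> x; have -> : stone_cech_coord v (stone_cech_unit x) = u x by [].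
by rewrite /u; field; lra.
Qed.

(** The universal property of the compactification in a form suited to
    C*-embedding: the map is only known on a dense set D of Y.  The extensions
    of the functions u o s are the coordinates of h, and the values of h stay in
    the closure of the image of X because those on D lie in that image. *)
Lemma stone_cech_lift (Y : topologicalType) (D : set Y) (s : Y -> X) :
  dense D ->
  (forall u : X -> R, continuous u -> (forall x, 0 <= u x <= 1) ->
     exists2 h : Y -> R, continuous h & forall y, D y -> h y = u (s y)) ->
  exists2 h : Y -> bX, continuous h &
    forall y, D y -> h y = stone_cech_unit (s y).
Proof.
move=> dD ext.
have /choice[H HP] : forall u : set_type (@unit_valued_maps R X),
    exists h : Y -> R, continuous h /\ forall y, D y -> h y = set_val u (s y).
  by move=> u; have [cu u01] := set_valP u; have [h] := ext _ cu u01; exists h.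
pose k (y : Y) : prod_topology (fun _ : set_type (@unit_valued_maps R X) => R) :=
  fun u => H u y.
have ck : continuous k by apply: prod_topology_continuous => u; exact: (HP u).1.
have kD y : D y -> k y = eval (s y).
  by move=> Dy; apply/funext => u; exact: (HP u).2.
have kcl y : closure (range eval) (k y).
  suff kT : k @^-1` closure (range eval) = setT.
    by have : (k @^-1` closure (range eval)) y by rewrite kT.
  apply: (closed_dense_setT dD).
    by apply: ((continuous_closedP k).1 ck); exact: closed_closure.
  by move=> z Dz; rewrite /preimage /= kD //; apply: subset_closure; exists (s z).
exists (fun y => exist _ (k y) (mem_set (kcl y))).
  apply: continuous_to_stone_cech => u; exact: (HP u).1.
by move=> y Dy; apply: val_inj => /=; exact: kD.
Qed.

End StoneCech.

Arguments stone_cech_unit R {X} x.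

(** * Stone-Cech and one-point compactifications of a discrete space *)

Section StoneCechDiscrete.
Variables (R : realType) (X : discreteTopologicalType).

Local Notation bX := (stone_cech R X).
Local Notation aX := (one_point_compactification X).
Local Notation eta := (@stone_cech_unit R X).

Lemma discrete_continuous (Y : topologicalType) (f : X -> Y) : continuous f.
Proof. by apply/continuousP => A _; exact: discrete_open. Qed.

Lemma stone_cech_separates (x : X) :
  exists2 h : bX -> R, continuous h & forall z, h (eta z) = (z == x)%:R.
Proof.
apply: (@stone_cech_extension R X (fun z => (z == x)%:R) 1) => //.
  exact: discrete_continuous.
by move=> z; case: (z == x); rewrite ?normr1 ?normr0.
Qed.

Lemma stone_cech_unit_injective : injective eta.
Proof.
move=> z x ezx; have [h _ hE] := stone_cech_separates x.
apply/eqP; have := hE z; rewrite ezx hE eqxx.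
by case: (z == x) => // /eqP; rewrite oner_eq0.
Qed.

(** The set where the extended indicator function of x is positive is open, and
    its only point in the dense image of X is that of x. *)
Lemma stone_cech_unit_isolated (x : X) : open [set eta x].
Proof.
have [h ch hE] := stone_cech_separates x.
pose O := h @^-1` [set r | 0 < r].
have oO : open O by apply: open_comp => // y _; exact: ch.
rewrite (_ : [set eta x] = O) //; apply/seteqP; split=> [_ ->|].
  by rewrite /O /preimage /= hE eqxx ltr01.
have hb := (@stone_cech_compact_hausdorff R X).2.
apply: (eq_on_open_of_dense (f := id) (g := cst (eta x)) hb
  (@stone_cech_unit_dense R X) oO).
- by move=> y _; exact: cvg_id.
- by move=> y _; exact: cst_continuous.
- move=> _ /[swap] -[z _ <-]; rewrite /O /preimage /= hE.
  by have [->|] := eqVneq z x; rewrite ?ltxx.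
Qed.

Definition stone_cech_to_opc (y : bX) : aX :=
  if pselect (exists x, eta x = y) is left ex then Some (projT1 (cid ex))
  else None.

Lemma stone_cech_to_opc_unit x : stone_cech_to_opc (eta x) = Some x.
Proof.
rewrite /stone_cech_to_opc; case: pselect => [ex|]; last by case; exists x.
by case: cid => z /= /stone_cech_unit_injective ->.
Qed.

Lemma stone_cech_to_opc_SomeP y x : stone_cech_to_opc y = Some x -> y = eta x.
Proof.
rewrite /stone_cech_to_opc; case: pselect => // ex [] <-.
by case: cid => z /= ->.
Qed.

(** At the points outside X this uses that the image of a compact subset of X
    is closed in the compactification. *)
Lemma stone_cech_to_opc_continuous : continuous stone_cech_to_opc.
Proof.
move=> y A; case fy : (stone_cech_to_opc y) => [x|].
  rewrite (stone_cech_to_opc_SomeP fy) => /nbhs_singleton Ax.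
  have : nbhs (eta x) [set eta x].
    by apply: open_nbhs_nbhs; split => //; exact: stone_cech_unit_isolated.
  by apply: filterS => _ ->; rewrite /preimage /= stone_cech_to_opc_unit.
move=> [W [cW _] WA].
have clW : closed (eta @` W).
  apply: compact_closed; first exact: (@stone_cech_compact_hausdorff R X).2.
  by apply: continuous_compact cW; exact/continuous_subspaceT/discrete_continuous.
have : nbhs y (~` (eta @` W)).
  apply: open_nbhs_nbhs; split; first exact: closed_openC.
  by move=> [x _ xy]; move: fy; rewrite -xy stone_cech_to_opc_unit.
apply: filterS => z nWz; apply: WA.
case fz : (stone_cech_to_opc z) => [x|]; last by right.
left; exists x => // Wx; apply: nWz; exists x => //.
by rewrite (stone_cech_to_opc_SomeP fz).
Qed.

Lemma opc_compact_hausdorff : compact_hausdorff aX.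
Proof.
split; first exact: one_point_compactification_compact.
apply: one_point_compactification_hausdorff; last exact: discrete_hausdorff.
move=> x _; rewrite withinET; exists [set x]; first exact: discrete_set1.
by split; [exact: compact_set1|exact: discrete_closed].
Qed.

Lemma opc_Some_dense : ~ compact [set: X] -> dense (range (Some : X -> aX)).
Proof.
move=> ncX O [[x|] Ox oO]; first by exists (Some x); split.
have [W [cW _] WO] : nbhs (None : aX) O by exact: open_nbhs_nbhs.
have [x nWx] : exists x, ~ W x.
  apply/existsNP => WT; apply: ncX; rewrite (_ : setT = W) //.
  by apply/seteqP; split.
by exists (Some x); split; [apply: WO; left; exists x|exists x].
Qed.

Lemma stone_cech_to_opc_covering :
  ~ compact [set: X] -> covering_map stone_cech_to_opc.
Proof.
move=> ncX; have [cb hb] := @stone_cech_compact_hausdorff R X.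
have [_ ha] := opc_compact_hausdorff; split.
- exact: stone_cech_to_opc_continuous.
- apply: (closed_dense_setT (opc_Some_dense ncX)).
    by apply: compact_closed_map => //; exact: stone_cech_to_opc_continuous.
  by move=> _ [x _ <-]; exists (eta x); rewrite ?stone_cech_to_opc_unit.
- move=> F cF nF fF; apply: nF.
  apply: (closed_dense_setT (@stone_cech_unit_dense R X) cF) => _ [x _ <-].
  have [y Fy /stone_cech_to_opc_SomeP <-//] :
    (stone_cech_to_opc @` F) (Some x) by rewrite fF.
Qed.

(** A dense set contains all isolated points, so it contains the image of X; a
    bounded function on it is determined by its values there, and these extend
    to the whole compactification. *)
Lemma stone_cech_quasi_F : quasi_F R bX.
Proof.
move=> U [k ck UE] dU g cg bg.
have oU : open U.
  rewrite UE; apply: (@open_comp _ _ k [set r | r != 0]) => [y _|]; first exact: ck.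
  exact: open_neq.
have etaU x : U (eta x).
  by have [_ [->]] := dU [set eta x] (ex_intro _ _ erefl) (stone_cech_unit_isolated x).
have [M M0 gM] := ex_strict_bound_gt0 bg.
have [h ch hE] : exists2 h : bX -> R, continuous h &
    forall x, h (eta x) = (g \o eta) x.
  apply: (@stone_cech_extension R X (g \o eta) M) => //.
    exact: discrete_continuous.
  by move=> x; apply: ltW; apply: gM; exists (eta x).
exists h => //.
apply: (eq_on_open_of_dense (@Rhausdorff R) (@stone_cech_unit_dense R X) oU).
- by move=> y _; exact: ch.
- by rewrite -continuous_open_subspace.
- by move=> _ _ [x _ <-]; exact: hE.
Qed.

(** Points of X are alone in their fiber under p because they are isolated, and
    all remaining points are sent to infinity. *)
Lemma stone_cech_to_opc_factor (Y : topologicalType) (p : bX -> Y) :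
  hausdorff_space Y -> covering_map p ->
  exists2 h : Y -> aX, continuous h & stone_cech_to_opc = h \o p.
Proof.
move=> hY [cp sp irr]; have [cb _] := @stone_cech_compact_hausdorff R X.
have fiber x y : p y = p (eta x) -> y = eta x.
  by apply: irreducible_fiber_isolated => //; exact: stone_cech_unit_isolated.
apply: continuous_factor => //; first exact: stone_cech_to_opc_continuous.
move=> y y' pyy'.
case fy : (stone_cech_to_opc y) => [x|].
  have yE := stone_cech_to_opc_SomeP fy.
  by rewrite (fiber x y') ?stone_cech_to_opc_unit // -yE.
case fy' : (stone_cech_to_opc y') => [x|//].
have yE := stone_cech_to_opc_SomeP fy'.
by rewrite -fy (fiber x y) ?stone_cech_to_opc_unit // -yE.
Qed.

End StoneCechDiscrete.

(** * The quasi-F cover of the one-point compactification of N *)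

Lemma nat_not_compact : ~ compact [set: nat].
Proof.
move=> /(_ _ eventually_filter filterT)[n [_ cl]].
have [] := cl _ [set n] (nbhs_infty_gt n) (discrete_set1 n).
by move=> m [/= + mn]; rewrite mn ltnn.
Qed.

Lemma opc_nat_cozero (R : realType) :
  cozero_set R (range (Some : nat -> one_point_compactification nat)).
Proof.
(* The space N is sigma-compact, so a function vanishing only at infinity exists. *)
pose k (x : one_point_compactification nat) : R :=
  if x is Some n then n.+1%:R^-1 else 0.
exists k.
  case=> [n|] A.
    move=> /nbhs_singleton kA; suff : nbhs n (Some @^-1` (k @^-1` A)) by [].
    by apply: open_nbhs_nbhs; split => //; exact: discrete_open.
  move=> /nbhs_ballP[e /= e0 eA].
  have [N _ NP] := near_infty_natSinv_lt (PosNum e0).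
  exists [set n | (n < N)%N].
    split; last exact: discrete_closed.
    by apply: finite_compact; exact: finite_II.
  move=> _ [[n /= /negP nN <-]|->]; apply: eA; rewrite /ball /= sub0r normrN.
    by rewrite ger0_norm ?invr_ge0//; apply: NP; rewrite /= leqNgt.
  by rewrite normr0.
apply/seteqP; split => [_ [n _ <-]|[n|]] /=; first by rewrite invr_eq0 pnatr_eq0.
  by exists n.
by rewrite eqxx.
Qed.

Lemma cozero_preimage (R : realType) (X Y : topologicalType) (f : Y -> X)
    (U : set X) :
  continuous f -> cozero_set R U -> cozero_set R (f @^-1` U).
Proof.
move=> cf [k ck ->]; exists (k \o f) => // y.
by apply: continuous_comp; [exact: cf|exact: ck].
Qed.

(** The quasi-F property is applied to the dense cozero-set over N, on which g
    is locally constant; there, functions on N pull back to continuous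
    functions. *)
Lemma quasi_F_cover_opc_nat_factor (R : realType)
    (Y : topologicalType) (g : Y -> one_point_compactification nat) :
  compact [set: Y] -> covering_map g -> quasi_F R Y ->
  exists2 h : Y -> stone_cech R nat, continuous h &
    g = @stone_cech_to_opc R nat \o h.
Proof.
move=> cY cov qF; have [cg sg irr] := cov.
have [_ ha] := opc_compact_hausdorff nat.
pose U := g @^-1` (range Some).
have oU : open U.
  apply: open_comp => [y _|]; first exact: cg.
  exact: one_point_compactification_open_some openT.
have dU : dense U.
  by apply: preimage_dense => //; exact: opc_Some_dense nat_not_compact.
have cU : cozero_set R U by apply: cozero_preimage => //; exact: opc_nat_cozero.
(* The default value 0 is taken only outside U. *)
pose s y := odflt 0%N (g y).
have sU y : U y -> Some (s y) = g y by rewrite /U /s /preimage /= => -[n _ <-].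
have [h ch hE] : exists2 h : Y -> stone_cech R nat, continuous h &
    forall y, U y -> h y = stone_cech_unit R (s y).
  apply: stone_cech_lift => // u _ u01; apply: (qF U cU dU (u \o s)).
    rewrite continuous_open_subspace // => y /set_mem Uy.
    apply: cvg_near_cst.
    have : nbhs y (g @^-1` [set g y]).
      apply: cg; rewrite -(sU y Uy) -image_set1; apply: open_nbhs_nbhs.
      split; last by exists (s y).
      exact/one_point_compactification_open_some/discrete_open.
    by apply: filterS => z; rewrite /preimage /= /s => ->.
  exists 1; split => // M M1 _ [y _ <-] /=.
  by have /andP[u0 u1] := u01 (s y); rewrite ger0_norm // (le_trans u1) // ltW.
exists h => //; apply: (eq_of_dense ha dU cg) => [y|y Uy /=].
  apply: continuous_comp; [exact: ch|exact: stone_cech_to_opc_continuous].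
by rewrite hE // stone_cech_to_opc_unit sU.
Qed.

(** * Almost-P spaces *)

Lemma almost_P_quasi_F (R : realType) (X : topologicalType) :
  almost_P R X -> quasi_F R X.
Proof.
move=> aP U cU dU g; rewrite (aP U cU dU) => cg _; exists g => //.
exact/continuous_subspace_setT.
Qed.

Lemma covering_almost_P (R : realType) (X K : topologicalType) (p : K -> X) :
  compact [set: K] -> hausdorff_space X -> covering_map p ->
  almost_P R K -> almost_P R X.
Proof.
move=> cK hX cov aP U cU dU; have [cp sp _] := cov.
have pU : p @^-1` U = setT.
  by apply: aP; [exact: cozero_preimage|exact: preimage_dense].
rewrite -subTset -sp => _ [y _ <-].
by have : (p @^-1` U) y by rewrite pU.
Qed.

Lemma covering_map_id (X : topologicalType) : covering_map (@idfun X).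
Proof.
split; [by move=> x; exact: cvg_id|by rewrite image_id|].
by move=> F _; rewrite image_id.
Qed.

(** Every cover of X lies above the identity of X, through its own covering
    map. *)
Lemma quasi_F_cover_id (R : realType) (X : topologicalType) :
  compact_hausdorff X -> quasi_F R X ->
  is_qF_cover R (SpaceOver (@idfun X)).
Proof.
move=> chX qF; split.
  by split => //; split => //; exact: covering_map_id.
move=> c [[_ [cc _ _]] _]; by exists (@over_map X c).
Qed.

(** The set s(X) is closed and p maps it onto X, so by irreducibility it is the
    whole of K. *)
Lemma covering_section_cancel (X K : topologicalType) (p : K -> X) (s : X -> K) :
  compact [set: X] -> hausdorff_space K -> covering_map p ->
  continuous s -> p \o s = id -> s \o p = id.
Proof.
move=> cX hK [_ _ irr] cs ps.
have sT : range s = setT.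
  apply: contrapT => /(irr _ (compact_closed_map cX hK cs closedT)); apply.
  by rewrite image_comp ps image_id.
apply/funext => y; have [x _ <-] : range s y by rewrite sT.
by rewrite /= -[p (s x)]/((p \o s) x) ps.
Qed.

(** The space X is itself quasi-F, so minimality of the cover p, compared with
    the identity of X, gives a section of p. *)
Lemma almost_P_le_S_qF (R : realType) (K : topologicalType) (p : space_under K) :
  compact_hausdorff K -> almost_P R K -> S_qF R p ->
  under_le (SpaceUnder (@idfun K)) p.
Proof.
case: p => X p [cK hK] aP [[cX hX] [[[_ cov] _] minp]] /=.
have qX : quasi_F R X.
  exact: almost_P_quasi_F (covering_almost_P cK hX cov aP).
have [s [cs /esym ps]] :=
  minp (SpaceOver (@idfun X)) (conj (conj (conj cX hX) (covering_map_id X)) qX).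
by exists s; split => //=; rewrite (covering_section_cancel cX hK cov cs ps).
Qed.

Theorem theorem5p6 (R : realType) :
  (exists f : stone_cech R nat -> one_point_compactification nat,
     is_minimum (@under_le (stone_cech R nat)) (@S_qF R (stone_cech R nat))
       (SpaceUnder f))
  /\
  (forall K : topologicalType, compact_hausdorff K -> almost_P R K ->
     [/\ S_qF R (SpaceUnder (@idfun K)),
         (forall p : space_under K, S_qF R p ->
            under_equiv p (SpaceUnder (@idfun K)))
       & is_minimum (@under_le K) (@S_qF R K) (SpaceUnder (@idfun K))]).
Proof.
split.
  exists (@stone_cech_to_opc R nat); split.
    split; first exact: (opc_compact_hausdorff nat).
    split.
      split; last exact: (@stone_cech_quasi_F R nat).
      split; first exact: stone_cech_compact_hausdorff.
      exact/stone_cech_to_opc_covering/nat_not_compact.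
    move=> [Y g] [[[cY _] cov] qY] /=.
    by have [h ch gE] := quasi_F_cover_opc_nat_factor cY cov qY; exists h.
  move=> [Y p] [[_ hY] [[[_ cov] _] _]].
  by have [h ch fE] := stone_cech_to_opc_factor hY cov; exists h.
move=> K chK aP.
have SK : S_qF R (SpaceUnder (@idfun K)).
  by split => //; exact: quasi_F_cover_id chK (almost_P_quasi_F aP).
split => //; last by split => // p; exact: almost_P_le_S_qF.
move=> p Sp; split; last exact: almost_P_le_S_qF Sp.
by have [_ [[[_ [cp _ _]] _] _]] := Sp; exists (@under_map K p).
Qed.
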